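(* Let $H\subset\mathbb{R}^2$ be a closed hexagon with sides parallel to the coordinate axes, and let $H=R_1\cup R_2$ be its unique representation as a union of two maximal rectangles. Let $f\in M(H)$. Then $$E(f,H)=\max\{|l(f,h)|,\ |l(f,r_1)|,\ |l(f,r_2)|\},$$ where $h,r_1,r_2$ are the closed bolts formed by the vertices of the polygons $H,R_1,R_2$, respectively.
   Context: All rectangles have sides parallel to the coordinate axes. A hexagon with sides parallel to the axes is uniquely represented as $H=R_1\cup R_2$ with rectangles $R_1,R_2$ such that no rectangle contained in $H$ properly contains $R_1$ or $R_2$. $M(H)$ is the class of continuous functions $f:H\to\mathbb{R}$ with $f(x_1,y_1)+f(x_2,y_2)-f(x_1,y_2)-f(x_2,y_1)\ge0$ for every rectangle $[x_1,x_2]\times[y_1,y_2]\subset H$. $E(f,H)=\inf\max_{(x,y)\in H}|f(x,y)-\varphi(x)-\psi(y)|$, the infimum being over all functions $\varphi,\psi$ continuous on the projections of $H$ onto the $x$- and $y$-axes, respectively. The vertices of an axis-parallel polygon with $2n$ vertices, listed in their cyclic order along the boundary, form a closed bolt $p=\{p_1,\dots,p_{2n}\}$ (consecutive points alternately share abscissa and ordinate), and $l(f,p)=\frac1{2n}\sum_{k=1}^{2n}(-1)^{k-1}f(p_k)$; the starting vertex and orientation affect $l(f,p)$ only by sign. *)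

(* Defs.v *)
From mathcomp Require Import all_boot all_order all_algebra.
From mathcomp Require Import all_classical all_reals all_analysis.

Set Implicit Arguments.
Unset Strict Implicit.
Unset Printing Implicit Defensive.

Import Order.TTheory GRing.Theory Num.Theory.
Import numFieldNormedType.Exports.

Local Open Scope classical_set_scope.
Local Open Scope ring_scope.

(* The points of a bolt are indexed from 0 by 'I_(2 * n); [ordS] is the cyclic
   successor. The flag [b] says whether the side from point 0 to point 1 is
   horizontal or vertical: either is allowed. *)
Definition closed_bolt (R : realType) (n : nat) (p : 'I_(2 * n) -> R * R) :=
  (forall i, p i <> p (ordS i)) /\
  exists b : bool, forall i : 'I_(2 * n),
    if odd (i + b) then (p i).1 = (p (ordS i)).1
    else (p i).2 = (p (ordS i)).2.

Definition segment (R : realType) (u v : R * R) : set (R * R) :=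
  [set (1 - t) *: u + t *: v | t in `[0, 1]].

Definition side (R : realType) (m : nat) (p : 'I_m -> R * R) (i : 'I_m) :
    set (R * R) :=
  segment (p i) (p (ordS i)).

Definition boundary (R : realType) (m : nat) (p : 'I_m -> R * R) :
    set (R * R) :=
  \bigcup_i side p i.

(* Adjacent sides of a closed bolt are perpendicular, so they meet only at
   their common vertex. *)
Definition simple_bolt (R : realType) (m : nat) (p : 'I_m -> R * R) :=
  forall i j, j <> i -> j <> ordS i -> i <> ordS j ->
    side p i `&` side p j = set0.

(* The curve together with the bounded components of its complement. *)
Definition enclosed_region (R : realType) (m : nat) (p : 'I_m -> R * R) :
    set (R * R) :=
  boundary p `|`
  [set z | ~ boundary p z /\
           bounded_set (connected_component (~` boundary p) z)].

(* [P] is a closed polygon with sides parallel to the axes, and [p] lists its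
   2n vertices in cyclic order, from any starting vertex, in either direction. *)
Definition polygon_with_vertices (R : realType) (n : nat) (P : set (R * R))
    (p : 'I_(2 * n) -> R * R) :=
  [/\ closed_bolt p, simple_bolt p & P = enclosed_region p].

Definition is_rectangle (R : realType) (Q : set (R * R)) :=
  exists x1 x2 y1 y2 : R,
    [/\ x1 < x2, y1 < y2 & Q = `[x1, x2] `*` `[y1, y2]].

Definition maximal_rectangle (R : realType) (H Q : set (R * R)) :=
  [/\ is_rectangle Q, Q `<=` H &
      forall Q', is_rectangle Q' -> Q' `<=` H -> ~ (Q `<` Q')].

Definition class_M (R : realType) (H : set (R * R)) (f : R * R -> R) :=
  {within H, continuous f} /\
  forall x1 x2 y1 y2 : R, x1 < x2 -> y1 < y2 ->
    `[x1, x2] `*` `[y1, y2] `<=` H ->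
    0 <= f (x1, y1) + f (x2, y2) - f (x1, y2) - f (x2, y1).

Definition deviations (R : realType) (f : R * R -> R) (H : set (R * R))
    (phi psi : R -> R) : set R :=
  [set `|f z - phi z.1 - psi z.2| | z in H].

Definition approx_error (R : realType) (f : R * R -> R) (H : set (R * R)) : R :=
  inf [set m | exists phi psi : R -> R,
         [/\ {within fst @` H, continuous phi},
             {within snd @` H, continuous psi},
             deviations f H phi psi m &
             ubound (deviations f H phi psi) m]].

Definition bolt_functional (R : realType) (n : nat) (f : R * R -> R)
    (p : 'I_(2 * n) -> R * R) : R :=
  (2 * n)%:R^-1 * \sum_(k < 2 * n) (-1) ^+ k * f (p k).

(* Main.v *)
Require Import Defs.
From mathcomp Require Import all_boot all_order all_algebra.
From mathcomp Require Import all_classical all_reals all_analysis.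
From mathcomp Require Import ring lra.

Set Implicit Arguments.
Unset Strict Implicit.
Unset Printing Implicit Defensive.

Import Order.TTheory GRing.Theory Num.Theory.
Import numFieldNormedType.Exports.

Local Open Scope classical_set_scope.
Local Open Scope ring_scope.

(** The lower bound holds for every closed bolt [p]: the alternating sum kills
    [phi x + psi y], so [l(f,p)] is an average of signed deviations over [p].

    For the upper bound, reflect the axes so that [H] is the union of
    [a1,a3] x [b1,b2] and [a1,a2] x [b1,b3], and regard the mixed difference of
    [f] as a nonnegative measure. It gives masses [al], [be], [ga] to the corner
    [a1,a2] x [b1,b2], the horizontal arm and the vertical arm, and the three
    functionals are (al+be)/4, (al+ga)/4 and (al+be+ga)/6. Take for [phi] and
    [psi] weighted sums of the marginals of the three restricted measures; a
    choice of weights brings the range of [f - phi - psi] down to twice the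
    largest of the three values.

    The bolt [h] is found from the region it encloses by tracing rays: no point
    from which a ray avoids the curve is enclosed. Of the six ways to omit one
    vertex per row and column of a 3 x 3 grid, the two diagonal ones make the
    curve cross itself and the other four are the reflections of one L. *)

(** * Choice of the weights *)

(** It lets weights be chosen through the weighted masses, in which all constraints are linear. *)
Lemma fraction_between (R : realType) (lo hi m v : R) :
  0 <= m -> lo <= hi -> lo * m <= v <= hi * m ->
  exists t, lo <= t <= hi /\ t * m = v.
Proof.
move=> m0 lohi /andP[lov vhi].
have [m00|mN0] := eqVneq m 0.
  by exists lo; split; [rewrite lexx | move: lov vhi; rewrite m00; lra].
have mp : 0 < m by rewrite lt_neqAle eq_sym mN0.
exists (v / m); split; last by rewrite divfK.
by rewrite ler_pdivlMr // lov ler_pdivrMr.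
Qed.

(** [P], [b], [g] stand for [p * al], [r2 * be], [q * ga]. Starting from half of [al] and no arm
    mass, [P] is raised while both residuals [al - P + be - b] and [al - P + ga - g] exceed [K],
    since it lowers both; then [b] and [g] remove the excess that is left. The total stays within
    [K] by the bound on [al + be + ga] when the smaller arm alone reaches [K], and otherwise by the
    bound on the corner with the larger arm. *)
Lemma split_masses (R : realType) (al be ga K : R) :
  0 <= al -> 0 <= be -> 0 <= ga ->
  al + be <= 2 * K -> al + ga <= 2 * K -> al + be + ga <= 3 * K ->
  exists P b g,
    [/\ 2^-1 * al <= P <= 1 * al, 0 * be <= b <= 1 * be, 0 * ga <= g <= 1 * ga,
        P + b + g <= K & al - P + be - b <= K /\ al - P + ga - g <= K].
Proof.
wlog gabe : be ga / ga <= be => [sym al0 be0 ga0 h1 h2 h3|al0 be0 ga0 h1 h2 h3].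
  have [le|/ltW le] := lerP ga be; first exact: sym.
  have h3' : al + ga + be <= 3 * K by lra.
  have [P [b [g [hP hb hg hK [hB hC]]]]] := sym _ _ le al0 ga0 be0 h2 h1 h3'.
  by exists P, g, b; split=> //; lra.
have [gaK|gaK] := lerP K ga.
  by exists al, (be - K), (ga - K); split; lra.
have [galK|galK] := lerP K (ga + 2^-1 * al).
  by exists (al + ga - K), (be - ga), 0; split; lra.
have [balK|balK] := lerP K (be + 2^-1 * al).
  by exists (2^-1 * al), (be + 2^-1 * al - K), 0; split; lra.
by exists (2^-1 * al), 0, 0; split; lra.
Qed.

(* [p] weighs the corner mass in both coordinates; [r] and [r2] weigh the mass of
   the horizontal arm in the x- and in the y-direction, [q] and [q2] that of the
   vertical arm. The last five inequalities are what [corner_deviation] and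
   [arm_deviation] need to confine the deviation to an interval of length [K]. *)
Lemma weights_exist (R : realType) (al be ga K : R) :
  0 <= al -> 0 <= be -> 0 <= ga ->
  al + be <= 2 * K -> al + ga <= 2 * K -> al + be + ga <= 3 * K ->
  exists p r r2 q q2,
    [/\ 2^-1 <= p <= 1, (0 <= r <= 1) && (0 <= r2 <= 1),
        (0 <= q <= 1) && (0 <= q2 <= 1) &
     [/\ p * al + r2 * be + q * ga <= K,
        p * al + r * be + q * ga <= K, p * al + r2 * be + q2 * ga <= K,
        (1 - r - r2) * be <= q * ga + (2 * p - 1) * al &
        (1 - q - q2) * ga <= r2 * be + (2 * p - 1) * al]].
Proof.
move=> al0 be0 ga0 h1 h2 h3.
have [P [b [g [hP hb hg hK [hB hC]]]]] :=
  split_masses al0 be0 ga0 h1 h2 h3.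
have half_le1 : 2^-1 <= 1 :> R by lra.
have [p [hp Ep]] := fraction_between al0 half_le1 hP.
have [r2 [hr2 Er2]] := fraction_between be0 ler01 hb.
have [q [hq Eq]] := fraction_between ga0 ler01 hg.
(* [S] is [r * be], as large as [be] and the budget [K - P - g] allow; the bound [hB] on the
   residual says that this is large enough. [T] is [q2 * ga], likewise with [hC]. *)
have [S [hS S1 S2]] : exists S, [/\ 0 * be <= S <= 1 * be, P + S + g <= K &
    be - S - b <= g + 2 * P - al].
  by have [h4|h4] := lerP (K - P - g) be; [exists (K - P - g)|exists be]; split; lra.
have [T [hT T1 T2]] : exists T, [/\ 0 * ga <= T <= 1 * ga, P + b + T <= K &
    ga - T - g <= b + 2 * P - al].
  by have [h4|h4] := lerP (K - P - b) ga; [exists (K - P - b)|exists ga]; split; lra.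
have [r [hr Er]] := fraction_between be0 ler01 hS.
have [q2 [hq2 Eq2]] := fraction_between ga0 ler01 hT.
exists p, r, r2, q, q2; rewrite hr hr2 hq hq2; split => //.
rewrite !(mulrBl, mul1r) -!mulrA Ep Er2 Eq Er Eq2; clear - hK S1 T1 S2 T2.
by split; lra.
Qed.

(* [LL], [UL], [LR], [UR] are the masses of the four quadrants cut out of a
   rectangle by a point, first letter vertical, second horizontal; [Bl], [Bu]
   and [Cl], [Cr] split the two arms. *)
Lemma corner_deviation (R : realType) (p r2 q LL UL LR UR Bl Bu Cl Cr : R) :
  2^-1 <= p <= 1 -> 0 <= r2 -> 0 <= q ->
  0 <= LL -> 0 <= UL -> 0 <= LR -> 0 <= UR ->
  0 <= Bl -> 0 <= Bu -> 0 <= Cl -> 0 <= Cr ->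
  - (p * (LL + UL + LR + UR) + r2 * (Bl + Bu) + q * (Cl + Cr)) <=
  LL - p * (LL + UL) - q * Cl - p * (LL + LR) - r2 * Bl <= 0.
Proof.
move=> /andP[p0 p1] r0 q0 *.
have [p2 p3 p4] : [/\ 0 <= p, 0 <= 1 - p & 0 <= 2 * p - 1] by split; lra.
have pLL : 0 <= (2 * p - 1) * LL by apply: mulr_ge0.
have pLL' : 0 <= (1 - p) * LL by apply: mulr_ge0.
have pUL : 0 <= p * UL by apply: mulr_ge0.
have pLR : 0 <= p * LR by apply: mulr_ge0.
have pUR : 0 <= p * UR by apply: mulr_ge0.
have rBl : 0 <= r2 * Bl by apply: mulr_ge0.
have rBu : 0 <= r2 * Bu by apply: mulr_ge0.
have qCl : 0 <= q * Cl by apply: mulr_ge0.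
have qCr : 0 <= q * Cr by apply: mulr_ge0.
by apply/andP; split; lra.
Qed.

(** The expression is linear in the masses. No coefficient of a quadrant is below minus the larger
    of [r] and [r2], so one of the two bounds by [K] gives the lower estimate. Only [LL] can have a
    positive coefficient, [1 - r - r2], and the last hypothesis absorbs it. *)
Lemma arm_deviation (R : realType) (p r r2 q Al Au LL UL LR UR ga K : R) :
  let be := LL + UL + LR + UR in
  2^-1 <= p <= 1 -> 0 <= r <= 1 -> 0 <= r2 <= 1 -> 0 <= q ->
  0 <= Al -> 0 <= Au -> 0 <= LL -> 0 <= UL -> 0 <= LR -> 0 <= UR -> 0 <= ga ->
  p * (Al + Au) + r2 * be + q * ga <= K ->
  p * (Al + Au) + r * be + q * ga <= K ->
  (1 - r - r2) * be <= q * ga + (2 * p - 1) * (Al + Au) ->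
  - K <= Al + LL - p * (Al + Au) - r * (LL + UL) - q * ga - p * Al - r2 * (LL + LR)
     <= 0.
Proof.
move=> be /andP[p0 p1] /andP[r0 r1] /andP[s0 s1] q0; rewrite /be {be}.
move=> Al0 Au0 L0 U0 V0 W0 ga0 h1 h2 h3.
have [p3 p4 r3 s3] : [/\ 0 <= 1 - p, 0 <= 2 * p - 1, 0 <= 1 - r & 0 <= 1 - r2].
  by split; lra.
have pAl := mulr_ge0 p3 Al0.
have pAu := mulr_ge0 p3 Au0.
have pAl' := mulr_ge0 p4 Al0.
have pAu' := mulr_ge0 p4 Au0.
have qg := mulr_ge0 q0 ga0.
have rL := mulr_ge0 r0 L0.
have sL := mulr_ge0 s0 L0.
have rU := mulr_ge0 r0 U0.
have sU := mulr_ge0 s0 U0.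
have rV := mulr_ge0 r0 V0.
have sV := mulr_ge0 s0 V0.
have rW := mulr_ge0 r0 W0.
have sW := mulr_ge0 s0 W0.
have rL' := mulr_ge0 r3 L0.
have sL' := mulr_ge0 s3 L0.
apply/andP; split.
  have [rs|rs] := lerP r r2.
    have : 0 <= (r2 - r) * UL by apply: mulr_ge0; lra.
    lra.
  have : 0 <= (r - r2) * LR by apply: mulr_ge0; lra.
  lra.
have [rs|rs] := lerP 0 (1 - r - r2).
  have : 0 <= (1 - r - r2) * (UL + LR + UR) by apply: mulr_ge0; lra.
  lra.
have : 0 <= (r + r2 - 1) * LL by apply: mulr_ge0; lra.
lra.
Qed.

(** * Mixed differences, clamping and continuity *)

Definition increment (R : realType) (f : R * R -> R) (x x' y y' : R) : R :=
  f (x, y) + f (x', y') - f (x, y') - f (x', y).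

Definition L_shape (R : realType) (a1 a2 a3 b1 b2 b3 : R) : set (R * R) :=
  `[a1, a3] `*` `[b1, b2] `|` `[a1, a2] `*` `[b1, b3].

(** [class_M] speaks of nondegenerate rectangles; a degenerate one has increment zero, so points on
    the dividing lines need no separate care. *)
Lemma class_M_increment_ge0 (R : realType) (H : set (R * R)) (f : R * R -> R)
    (x x' y y' : R) :
  class_M H f -> x <= x' -> y <= y' -> `[x, x'] `*` `[y, y'] `<=` H ->
  0 <= increment f x x' y y'.
Proof.
move=> [_ fM]; rewrite /increment le_eqVlt => /orP[/eqP <-|xx'].
  by move=> *; lra.
by rewrite le_eqVlt => /orP[/eqP <-|yy']; [move=> *; lra|exact: fM].
Qed.

Lemma within_continuous_comp (R : realType) (S T U : topologicalType) (A : set T)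
    (f : T -> U) (g : S -> T) :
  {within A, continuous f} -> (forall x, A (g x)) -> continuous g ->
  continuous (f \o g).
Proof.
move=> /subspace_continuousP fA gA gc x; apply: cvg_comp (fA _ (gA x)).
move=> B /gc; rewrite /= /nbhs /= => nB; near=> y.
by apply: (near nB y).
Unshelve. all: by end_near.
Qed.

Definition clamp (R : realType) (lo hi x : R) : R := Num.max lo (Num.min x hi).

Lemma clamp_id (R : realType) (lo hi x : R) : lo <= x <= hi -> clamp lo hi x = x.
Proof. by move=> /andP[l h]; rewrite /clamp (min_idPl h) (max_idPr l). Qed.

Lemma clamp_lo (R : realType) (lo hi x : R) : x <= lo -> lo <= hi -> clamp lo hi x = lo.
Proof. by move=> l h; apply/max_idPl; rewrite ge_min l. Qed.

Lemma clamp_hi (R : realType) (lo hi x : R) : hi <= x -> lo <= hi -> clamp lo hi x = hi.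
Proof. by move=> l h; rewrite /clamp (min_idPr l) (max_idPr h). Qed.

Lemma clamp_itv (R : realType) (lo hi x : R) : lo <= hi -> lo <= clamp lo hi x <= hi.
Proof. by move=> h; rewrite /clamp le_max lexx ge_max h ge_min lexx orbT. Qed.

Lemma continuous_clamp (R : realType) (lo hi : R) : continuous (clamp lo hi).
Proof.
move=> x; rewrite /clamp; apply: (@continuous_max R R (cst lo) (Num.min ^~ hi)).
  exact: cvg_cst.
apply: (@continuous_min R R id (cst hi)); first exact: cvg_id.
exact: cvg_cst.
Qed.

Lemma continuous_curve (R : realType) (H : set (R * R)) (f : R * R -> R)
    (u v : R -> R) :
  {within H, continuous f} -> (forall t, H (u t, v t)) ->
  continuous u -> continuous v -> continuous (fun t => f (u t, v t)).
Proof.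
move=> fc uvH uc vc.
have gc : continuous (fun t => (u t, v t)).
  by move=> t; exact: cvg_pair (uc t) (vc t).
exact: within_continuous_comp fc uvH gc.
Qed.

Lemma continuous_increment (R : realType) (H : set (R * R)) (f : R * R -> R)
    (u u' v v' : R -> R) :
  {within H, continuous f} ->
  (forall t, [/\ H (u t, v t), H (u' t, v' t), H (u t, v' t) & H (u' t, v t)]) ->
  continuous u -> continuous u' -> continuous v -> continuous v' ->
  continuous (fun t => increment f (u t) (u' t) (v t) (v' t)).
Proof.
move=> fc inH uc u'c vc v'c t; rewrite /increment.
have c1 := @continuous_curve _ _ _ _ _ fc (fun s => let: And4 h _ _ _ := inH s in h) uc vc t.
have c2 := @continuous_curve _ _ _ _ _ fc (fun s => let: And4 _ h _ _ := inH s in h) u'c v'c t.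
have c3 := @continuous_curve _ _ _ _ _ fc (fun s => let: And4 _ _ h _ := inH s in h) uc v'c t.
have c4 := @continuous_curve _ _ _ _ _ fc (fun s => let: And4 _ _ _ h := inH s in h) u'c vc t.
exact: continuousB (continuousB (continuousD c1 c2) c3) c4.
Qed.

(** * Approximation on a standard L *)

(** [f (x, y) - f (x, b1) - f (a1, y) + f (a1, b1)] is the mass of the rectangle from [(a1, b1)] to
    [(x, y)]. Subtracting the weighted marginals from it leaves the expressions of
    [corner_deviation] and [arm_deviation], confined to length [K = 2 * M]. *)
Lemma L_shape_approximation (R : realType) (a1 a2 a3 b1 b2 b3 M : R)
    (f : R * R -> R) :
  a1 <= a2 <= a3 -> b1 <= b2 <= b3 ->
  class_M (L_shape a1 a2 a3 b1 b2 b3) f ->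
  increment f a1 a3 b1 b2 <= 4 * M -> increment f a1 a2 b1 b3 <= 4 * M ->
  increment f a1 a3 b1 b2 + increment f a1 a2 b2 b3 <= 6 * M ->
  exists phi psi : R -> R, [/\ continuous phi, continuous psi &
    forall z, L_shape a1 a2 a3 b1 b2 b3 z -> `|f z - phi z.1 - psi z.2| <= M].
Proof.
move=> /andP[a12 a23] /andP[b12 b23] fM hW hT hL.
have incW x x' y y' : a1 <= x -> x <= x' -> x' <= a3 -> b1 <= y -> y <= y' ->
    y' <= b2 -> 0 <= increment f x x' y y'.
  move=> ? xx' ? ? yy' ?; apply: class_M_increment_ge0 fM xx' yy' _.
  move=> [s t] [/=]; rewrite !in_itv /= => /andP[? ?] /andP[? ?].
  by left; split; rewrite /= in_itv /=; apply/andP; split; lra.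
have incT x x' y y' : a1 <= x -> x <= x' -> x' <= a2 -> b1 <= y -> y <= y' ->
    y' <= b3 -> 0 <= increment f x x' y y'.
  move=> ? xx' ? ? yy' ?; apply: class_M_increment_ge0 fM xx' yy' _.
  move=> [s t] [/=]; rewrite !in_itv /= => /andP[? ?] /andP[? ?].
  by right; split; rewrite /= in_itv /=; apply/andP; split; lra.
have [al0 be0 ga0] : [/\ 0 <= increment f a1 a2 b1 b2,
    0 <= increment f a2 a3 b1 b2 & 0 <= increment f a1 a2 b2 b3].
  by split; [exact: incW|exact: incW|exact: incT].
have [||| p [r [r2 [q [q2 [hp /andP[hr hr2] /andP[hq hq2]
    [hA hB hC hB' hC']]]]]]] := @weights_exist R _ _ _ (2 * M) al0 be0 ga0.
- by move: hW; rewrite /increment; clear; lra.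
- by move: hT; rewrite /increment; clear; lra.
- by move: hL; rewrite /increment; clear; lra.
have [q0 r20] : 0 <= q /\ 0 <= r2 by case/andP: hq; case/andP: hr2.
have [a13 b13] : a1 <= a3 /\ b1 <= b3.
  by split; [exact: le_trans a23|exact: le_trans b23].
(* Clamping extends both functions continuously beyond the projections of [H]. *)
pose phi x := f (clamp a1 a3 x, b1)
  + p * increment f a1 (clamp a1 a2 x) b1 b2
  + q * increment f a1 (clamp a1 a2 x) b2 b3
  + r * increment f a2 (clamp a2 a3 x) b1 b2 - M.
pose psi y := f (a1, clamp b1 b3 y) - f (a1, b1)
  + p * increment f a1 a2 b1 (clamp b1 b2 y)
  + r2 * increment f a2 a3 b1 (clamp b1 b2 y)
  + q2 * increment f a1 a2 b2 (clamp b2 b3 y).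
have inL s t : a1 <= s <= a3 -> b1 <= t <= b3 -> (s <= a2) || (t <= b2) ->
    L_shape a1 a2 a3 b1 b2 b3 (s, t).
  move=> /andP[? ?] /andP[? ?] /orP[?|?]; [right|left];
    by split; rewrite /= in_itv /=; apply/andP.
have in12 s : a1 <= s <= a2 -> a1 <= s <= a3.
  by case/andP=> -> h; exact: le_trans a23.
have in23 s : a2 <= s <= a3 -> a1 <= s <= a3.
  by case/andP=> h ->; rewrite andbT; exact: le_trans h.
have in12' s : b1 <= s <= b2 -> b1 <= s <= b3.
  by case/andP=> -> h; exact: le_trans b23.
have in23' s : b2 <= s <= b3 -> b1 <= s <= b3.
  by case/andP=> h ->; rewrite andbT; exact: le_trans h.
have le12 (lo hi s : R) : lo <= s <= hi -> s <= hi by case/andP.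
have cc (c : R) : continuous (fun _ : R => c) by move=> ?; exact: cvg_cst.
exists phi, psi; split.
- have c13 := clamp_itv _ a13; have c12 := clamp_itv _ a12.
  have c23 := clamp_itv _ a23.
  have k1 := @continuous_curve R _ f (clamp a1 a3) (fun=> b1) fM.1
    ltac:(by move=> s; apply: inL; rewrite /= ?c12 ?c23 ?c13 ?(le12 _ _ _ (c12 _))
      ?lexx ?a12 ?a23 ?a13 ?b12 ?b23 ?b13 ?orbT)
    (@continuous_clamp _ _ _) (cc _).
  have k2 := @continuous_increment R _ f (fun=> a1) (clamp a1 a2) (fun=> b1) (fun=> b2) fM.1
    ltac:(by move=> s; split; apply: inL; rewrite /= ?in12 ?c12 ?c23 ?c13 ?(le12 _ _ _ (c12 _))
      ?lexx ?a12 ?a23 ?a13 ?b12 ?b23 ?b13 ?orbT)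
    (cc _) (@continuous_clamp _ _ _) (cc _) (cc _).
  have k3 := @continuous_increment R _ f (fun=> a1) (clamp a1 a2) (fun=> b2) (fun=> b3) fM.1
    ltac:(by move=> s; split; apply: inL; rewrite /= ?in12 ?c12 ?c23 ?c13 ?(le12 _ _ _ (c12 _))
      ?lexx ?a12 ?a23 ?a13 ?b12 ?b23 ?b13 ?orbT)
    (cc _) (@continuous_clamp _ _ _) (cc _) (cc _).
  have k4 := @continuous_increment R _ f (fun=> a2) (clamp a2 a3) (fun=> b1) (fun=> b2) fM.1
    ltac:(by move=> s; split; apply: inL; rewrite /= ?in23 ?c12 ?c23 ?c13 ?(le12 _ _ _ (c12 _))
      ?lexx ?a12 ?a23 ?a13 ?b12 ?b23 ?b13 ?orbT)
    (cc _) (@continuous_clamp _ _ _) (cc _) (cc _).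
  move=> x; exact: continuousB (continuousD (continuousD (continuousD (k1 x)
    (continuousM (cc p x) (k2 x))) (continuousM (cc q x) (k3 x)))
    (continuousM (cc r x) (k4 x))) (cc M x).
- have c13 := clamp_itv _ b13; have c12 := clamp_itv _ b12.
  have c23 := clamp_itv _ b23.
  have k1 := @continuous_curve R _ f (fun=> a1) (clamp b1 b3) fM.1
    ltac:(by move=> s; apply: inL; rewrite /= ?c12 ?c23 ?c13 ?(le12 _ _ _ (c12 _))
      ?lexx ?a12 ?a23 ?a13 ?b12 ?b23 ?b13 ?orbT)
    (cc _) (@continuous_clamp _ _ _).
  have k2 := @continuous_increment R _ f (fun=> a1) (fun=> a2) (fun=> b1) (clamp b1 b2) fM.1
    ltac:(by move=> s; split; apply: inL; rewrite /= ?in12' ?c12 ?c23 ?c13 ?(le12 _ _ _ (c12 _))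
      ?lexx ?a12 ?a23 ?a13 ?b12 ?b23 ?b13 ?orbT)
    (cc _) (cc _) (cc _) (@continuous_clamp _ _ _).
  have k3 := @continuous_increment R _ f (fun=> a2) (fun=> a3) (fun=> b1) (clamp b1 b2) fM.1
    ltac:(by move=> s; split; apply: inL; rewrite /= ?in12' ?c12 ?c23 ?c13 ?(le12 _ _ _ (c12 _))
      ?lexx ?a12 ?a23 ?a13 ?b12 ?b23 ?b13 ?orbT)
    (cc _) (cc _) (cc _) (@continuous_clamp _ _ _).
  have k4 := @continuous_increment R _ f (fun=> a1) (fun=> a2) (fun=> b2) (clamp b2 b3) fM.1
    ltac:(by move=> s; split; apply: inL; rewrite /= ?in23' ?c12 ?c23 ?c13 ?(le12 _ _ _ (c12 _))
      ?lexx ?a12 ?a23 ?a13 ?b12 ?b23 ?b13 ?orbT)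
    (cc _) (cc _) (cc _) (@continuous_clamp _ _ _).
  move=> y; exact: continuousD (continuousD (continuousD (continuousB (k1 y) (cc _ y))
    (continuousM (cc p y) (k2 y))) (continuousM (cc r2 y) (k3 y)))
    (continuousM (cc q2 y) (k4 y)).
clear hW hT hL fM.
move=> [x y] Lxy; rewrite ler_norml /=.
(* The summand [- M] in [phi] centres this interval at zero. *)
suff : - (2 * M) <= f (x, y) - (phi x + M) - psi y <= 0.
  by clear; move=> /andP[? ?]; apply/andP; split; lra.
have [/andP[ax xa] /andP[bly yb] {}Lxy] : [/\ a1 <= x <= a3, b1 <= y <= b3 & x <= a2 \/ y <= b2].
  by case: Lxy => -[/=]; rewrite !in_itv /= => /andP[ax xa] /andP[bly yb];
     rewrite ax bly ?xa ?yb; split; auto; [exact: le_trans b23|exact: le_trans a23].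
rewrite /phi /psi (@clamp_id _ a1 a3) ?ax // (@clamp_id _ b1 b3) ?bly //.
have [xa2|a2x] := lerP x a2; have [yb2|b2y] := lerP y b2.
- rewrite (@clamp_id _ a1 a2) ?ax // (@clamp_id _ b1 b2) ?bly //.
  (* The marginals of the two arms are clamped to degenerate rectangles here and vanish. *)
  rewrite !clamp_lo //.
  have /andP[lo hi] := @corner_deviation R p r2 q (increment f a1 x b1 y)
    (increment f a1 x y b2) (increment f x a2 b1 y) (increment f x a2 y b2)
    (increment f a2 a3 b1 y) (increment f a2 a3 y b2)
    (increment f a1 x b2 b3) (increment f x a2 b2 b3) hp r20 q0
    ltac:(by apply: incW) ltac:(by apply: incW) ltac:(by apply: incW)
    ltac:(by apply: incW) ltac:(by apply: incW) ltac:(by apply: incW)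
    ltac:(by apply: incT) ltac:(by apply: incT).
  clear - lo hi hA; move: lo hi hA; rewrite /increment => lo hi hA.
  by apply/andP; split; lra.
- have b2y' := ltW b2y.
  rewrite (@clamp_id _ a1 a2) ?ax // (@clamp_hi _ b1 b2) // (@clamp_id _ b2 b3) ?b2y' //.
  rewrite !clamp_lo //.
  (* The vertical arm is the horizontal one with the coordinates exchanged, so [q2], [q], [r2]
     replace [r], [r2], [q]. *)
  have /andP[lo hi] := @arm_deviation R p q2 q r2 (increment f a1 x b1 b2)
    (increment f x a2 b1 b2) (increment f a1 x b2 y) (increment f x a2 b2 y)
    (increment f a1 x y b3) (increment f x a2 y b3) (increment f a2 a3 b1 b2)
    (2 * M) hp hq2 hq r20
    ltac:(by apply: incW) ltac:(by apply: incW) ltac:(by apply: incT)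
    ltac:(by apply: incT) ltac:(by apply: incT) ltac:(by apply: incT) be0
    ltac:(by clear - hA; move: hA; rewrite /increment; lra)
    ltac:(by clear - hC; move: hC; rewrite /increment; lra)
    ltac:(by clear - hC'; move: hC'; rewrite /increment; lra).
  clear - lo hi; move: lo hi; rewrite /increment => lo hi.
  by apply/andP; split; lra.
- have a2x' := ltW a2x.
  rewrite (@clamp_id _ b1 b2) ?bly // (@clamp_hi _ a1 a2) // (@clamp_id _ a2 a3) ?a2x' //.
  rewrite !clamp_lo //.
  have /andP[lo hi] := @arm_deviation R p r r2 q (increment f a1 a2 b1 y)
    (increment f a1 a2 y b2) (increment f a2 x b1 y) (increment f a2 x y b2)
    (increment f x a3 b1 y) (increment f x a3 y b2) (increment f a1 a2 b2 b3)
    (2 * M) hp hr hr2 q0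
    ltac:(by apply: incW) ltac:(by apply: incW) ltac:(by apply: incW)
    ltac:(by apply: incW) ltac:(by apply: incW) ltac:(by apply: incW) ga0
    ltac:(by clear - hA; move: hA; rewrite /increment; lra)
    ltac:(by clear - hB; move: hB; rewrite /increment; lra)
    ltac:(by clear - hB'; move: hB'; rewrite /increment; lra).
  clear - lo hi; move: lo hi; rewrite /increment => lo hi.
  by apply/andP; split; lra.
- by move: Lxy; rewrite !leNgt a2x b2y; case.
Qed.

(** * The lower bound from closed bolts *)

(** Each index of one parity class cancels against its successor; signs still alternate across the
    wrap because [2 * n] is even. *)
Lemma alternating_sum_eq0 (R : realType) (n : nat) (b : bool) (g : 'I_(2 * n) -> R) :
  (forall i : 'I_(2 * n), odd (i + b) -> g i = g (ordS i)) ->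
  \sum_(i < 2 * n) (-1) ^+ i * g i = 0.
Proof.
move=> gS.
have oddS (i : 'I_(2 * n)) : odd (i.+1 %% (2 * n)) = ~~ odd i.
  by rewrite odd_mod // oddM.
rewrite (bigID (fun i : 'I_(2 * n) => odd (i + b))) /=.
rewrite [X in _ + X](reindex_inj (@ordS_inj _)) /=.
rewrite [X in _ + X](eq_bigl (fun i : 'I_(2 * n) => odd (i + b))); last first.
  by move=> i; rewrite !oddD oddS; case: odd; case: (b).
rewrite -big_split big1 //= => i /gS ->.
by rewrite -signr_odd -[(-1) ^+ (_ %% _)]signr_odd oddS; case: odd => /=; ring.
Qed.

(** One parity class of sides preserves abscissas and the other ordinates, so [phi] and [psi] drop
    out of the functional; an average cannot exceed all its terms in absolute value. *)
Lemma bolt_functional_deviation (R : realType) (n : nat) (p : 'I_(2 * n) -> R * R)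
    (f : R * R -> R) (phi psi : R -> R) :
  (0 < n)%N -> closed_bolt p ->
  exists i, `|bolt_functional f p| <= `|f (p i) - phi (p i).1 - psi (p i).2|.
Proof.
move=> n0 [_ [b pb]].
pose g z := f z - phi z.1 - psi z.2.
have -> : bolt_functional f p = bolt_functional g p.
  rewrite /bolt_functional; congr (_ * _).
  have /esym := @alternating_sum_eq0 R n b (fun i => phi (p i).1)
    ltac:(by move=> i oi; move: (pb i); rewrite oi => ->).
  have /esym := @alternating_sum_eq0 R n (~~ b) (fun i => psi (p i).2)
    ltac:(by move=> i oi; move: (pb i) oi; rewrite !oddD; case: odd; case: (b) => //= ->).
  move=> Epsi Ephi; apply/eqP; rewrite -subr_eq0 -sumrB.
  rewrite (eq_bigr (fun i : 'I_(2 * n) => (-1) ^+ i * phi (p i).1 + (-1) ^+ i * psi (p i).2)).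
    by rewrite big_split /= -Ephi -Epsi addr0.
  by move=> i _; rewrite /g; ring.
apply: contrapT => /forallNP small.
have n2 : 0 < (2 * n)%:R :> R by rewrite ltr0n muln_gt0.
suff : \sum_(i < 2 * n) `|g (p i)| < \sum_(i < 2 * n) `|bolt_functional g p|.
  apply/negP; rewrite -leNgt sumr_const card_ord -mulr_natl.
  rewrite /bolt_functional normrM gtr0_norm ?invr_gt0 // mulVKf ?gt_eqF //.
  apply: le_trans (ler_norm_sum _ _ _) _; apply: ler_sum => i _.
  by rewrite normrM normrX normrN1 expr1n mul1r.
have i0 : 'I_(2 * n) by exists 0; rewrite muln_gt0.
apply: ltr_sum; first by apply/hasP; exists i0 => //; rewrite mem_index_enum.
by move=> i _; rewrite ltNge; apply/negP/small.
Qed.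

Lemma approx_error_eq (R : realType) (n : nat) (p : 'I_(2 * n) -> R * R)
    (f : R * R -> R) (H : set (R * R)) (M : R) (phi psi : R -> R) :
  (0 < n)%N -> closed_bolt p -> (forall i, H (p i)) -> M = `|bolt_functional f p| ->
  continuous phi -> continuous psi ->
  (forall z, H z -> `|f z - phi z.1 - psi z.2| <= M) ->
  approx_error f H = M.
Proof.
move=> n0 pb pH ME phic psic fM.
rewrite /approx_error; set S := [set m | _].
have SM : lbound S M.
  move=> m [phi' [psi' [_ _ _ um]]].
  have [i] := bolt_functional_deviation f phi' psi' n0 pb.
  by rewrite ME => /le_trans; apply; apply: um; exists (p i).
have MS : S M.
  exists phi, psi; split.
  - exact: continuous_subspaceT.
  - exact: continuous_subspaceT.
  (* The maximum must be attained: some vertex of [p] deviates by at least [M], hence by exactly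
     [M]. *)
  - have [i] := bolt_functional_deviation f phi psi n0 pb.
    rewrite -ME => Mle; exists (p i) => //.
    by apply/eqP; rewrite eq_le Mle fM.
  - by move=> _ [z Hz <-]; exact: fM.
apply/eqP; rewrite eq_le; apply/andP; split.
  by apply: ge_inf => //; exists M.
by apply: lb_le_inf => //; exists M.
Qed.

(** * Segments, rays and enclosed regions *)

(** The endpoints are unordered because a side may be traversed either way. *)
Definition in_between (R : realType) (u v w : R) :=
  (u <= w <= v) || (v <= w <= u).

Lemma segment_pairE (R : realType) (x x' y y' c : R) :
  (1 - c) *: (x, y) + c *: (x', y') = ((1 - c) * x + c * x', (1 - c) * y + c * y') :> R * R.
Proof. by []. Qed.

Lemma in_betweenP (R : realType) (u v w : R) :
  in_between u v w <-> exists2 c, 0 <= c <= 1 & w = (1 - c) * u + c * v.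
Proof.
rewrite /in_between; split; last first.
  move=> [c /andP[c0 c1] ->]; have c1' : 0 <= 1 - c by lra.
  have [uv|/ltW vu] := lerP u v; apply/orP; [left|right]; apply/andP.
    have := mulr_ge0 c0 (_ : 0 <= v - u); have := mulr_ge0 c1' (_ : 0 <= v - u).
    by rewrite subr_ge0 => /(_ uv) ? /(_ uv) ?; split; lra.
  have := mulr_ge0 c0 (_ : 0 <= u - v); have := mulr_ge0 c1' (_ : 0 <= u - v).
  by rewrite subr_ge0 => /(_ vu) ? /(_ vu) ?; split; lra.
have [->|uv] := eqVneq u v.
  by move=> /orP[] /andP[? ?]; exists 0; rewrite ?lexx ?ler01 //; lra.
have vu0 : v - u != 0 by rewrite subr_eq0 eq_sym.
move=> wuv; exists ((w - u) / (v - u)); last by field.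
have [u_lt|v_le] := ltrP u v.
  have d0 : 0 < v - u by lra.
  rewrite ler_pdivlMr // ler_pdivrMr // mul0r mul1r.
  by move: wuv => /orP[] /andP[? ?]; apply/andP; split; lra.
have d0 : 0 < u - v by rewrite subr_gt0 lt_neqAle eq_sym uv.
have -> : (w - u) / (v - u) = (u - w) / (u - v) by field; apply/andP; split; lra.
rewrite ler_pdivlMr // ler_pdivrMr // mul0r mul1r.
by move: wuv => /orP[] /andP[? ?]; apply/andP; split; lra.
Qed.

Lemma segment_horizontal (R : realType) (x x' y : R) z :
  segment (x, y) (x', y) z <-> in_between x x' z.1 /\ z.2 = y.
Proof.
case: z => s t /=; split=> [[c]|[/in_betweenP[c c01 ->] ->]].
  rewrite segment_pairE /= in_itv /= => c01 [<- <-]; split; last by ring.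
  by apply/in_betweenP; exists c.
exists c; rewrite ?segment_pairE /= ?in_itv //=.
by congr (_, _); ring.
Qed.

Lemma segment_vertical (R : realType) (x y y' : R) z :
  segment (x, y) (x, y') z <-> z.1 = x /\ in_between y y' z.2.
Proof.
case: z => s t /=; split=> [[c]|[-> /in_betweenP[c c01 ->]]].
  rewrite segment_pairE /= in_itv /= => c01 [<- <-]; split; first by ring.
  by apply/in_betweenP; exists c.
exists c; rewrite ?segment_pairE /= ?in_itv //=.
by congr (_, _); ring.
Qed.

(** [enclosed_region] as a function of the curve as a point set, so that a curve can be given by
    equations. *)
Definition region (R : realType) (B : set (R * R)) : set (R * R) :=
  B `|` [set z | ~ B z /\ bounded_set (connected_component (~` B) z)].

(** The ray is a connected unbounded part of the complement, so the component of [z] is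
    unbounded. *)
Lemma region_escape (R : realType) (B : set (R * R)) (z d : R * R) :
  d != 0 -> (forall t, 0 <= t -> ~ B (z + t *: d)) -> ~ region B z.
Proof.
move=> d0 ray [Bz|[_ bnd]].
  by apply: (ray 0) => //; rewrite scale0r addr0.
have sub : [set z + t *: d | t in `[0, +oo[] `<=` connected_component (~` B) z.
  apply: connected_component_max.
  - by exists 0; rewrite /= ?in_itv /= ?lexx // scale0r addr0.
  - move=> w [t tI <-]; move: tI; rewrite /= in_itv /= andbT; exact: ray.
  - apply: connected_continuous_connected.
      by apply/connected_intervalP; exact: interval_is_interval.
    apply: continuous_subspaceT => t.
    have zc : {for t, continuous (fun _ : R => z)} by exact: cvg_cst.
    have dc : {for t, continuous (fun s : R => s *: d)}.
      by apply: cvgZr_tmp; exact: cvg_id.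
    exact: continuousD zc dc.
move: bnd; rewrite /= /bounded_near => -[M [_ bnd]].
have nd : 0 < `|d| by rewrite normr_gt0.
pose N := Num.max 0 M + 1.
have N0 : M < N by rewrite /N; case: (lerP 0 M) => ?; lra.
have NN : 0 <= N by rewrite /N; case: (lerP 0 M) => ?; lra.
(* At this parameter the norm of [z + t *: d] is at least [N + 1]. *)
pose t := (N + `|z| + 1) / `|d|.
have t0 : 0 <= t by rewrite divr_ge0 // addr_ge0 // addr_ge0.
have := bnd N N0 (z + t *: d); rewrite /=.
have memt : connected_component (~` B) z (z + t *: d).
  by apply: sub; exists t => //=; rewrite in_itv /= andbT.
move=> /(_ memt); apply/negP; rewrite -ltNge.
have := lerB_normD (t *: d) z; rewrite normrZ (ger0_norm t0) divfK ?gt_eqF // [_ + z]addrC.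
lra.
Qed.

(** Shifting the indices by [b] makes the first side horizontal and removes the flag. A shift by one
    flips every sign, hence the absolute values. *)
Lemma closed_bolt_unroll (R : realType) (n : nat) (p : 'I_(2 * n) -> R * R) :
  (0 < n)%N -> closed_bolt p ->
  exists s : nat -> 'I_(2 * n),
  [/\ forall k, ordS (s k) = s k.+1,
      forall k l, (s k == s l) = (k == l %[mod 2 * n]),
      forall i, exists2 k, (k < 2 * n)%N & s k = i,
      forall k, if odd k then (p (s k)).1 = (p (s k.+1)).1
                else (p (s k)).2 = (p (s k.+1)).2 &
      forall g : 'I_(2 * n) -> R,
        `|\sum_(i < 2 * n) (-1) ^+ i * g i| =
        `|\sum_(k < 2 * n) (-1) ^+ k * g (s k)|].
Proof.
move=> n0 [_ [b pb]].
have n2 : (0 < 2 * n)%N by rewrite muln_gt0.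
pose s k := Ordinal (ltn_pmod (k + b) n2).
have sS k : ordS (s k) = s k.+1 by apply: val_inj; rewrite /= -addn1 modnDml addn1.
exists s; split=> //.
- by move=> k l; rewrite -val_eqE /= eqn_modDr.
- move=> i; exists ((i + (2 * n - b)) %% (2 * n))%N; first by rewrite ltn_pmod.
  apply: val_inj; rewrite /= modnDml -addnA subnK ?modnDr ?modn_small //.
  by apply: (leq_trans _ n2); case: (b).
- move=> k; have := pb (s k); rewrite sS /= !oddD odd_mod ?oddM // oddD.
  by case: odd; case: (b).
move=> g; have sval k : (s k : nat) = ((k + b) %% (2 * n))%N by [].
move: sval; clearbody s; case: {pb} b => sval; last first.
  congr (`|_|); apply: eq_bigr => i _; congr (_ * g _).
  by apply: val_inj; rewrite /= sval addn0 modn_small.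
have sE (i : 'I_(2 * n)) : s i = ordS i by apply: val_inj; rewrite /= sval addn1.
rewrite (reindex_inj (@ordS_inj _)) /= -normrN -sumrN; congr (`|_|).
apply: eq_bigr => i _; rewrite sE -[(-1) ^+ (_ %% _)]signr_odd.
by rewrite odd_mod ?oddM //= -[(-1) ^+ i]signr_odd; case: odd => /=; ring.
Qed.

(** Points outside the region are off the curve, so if [z] were off it too, the whole ray would
    avoid the curve. This recovers the curve from its region. *)
Lemma region_edge (R : realType) (B : set (R * R)) (z d : R * R) :
  d != 0 -> region B z -> (forall t, 0 < t -> ~ region B (z + t *: d)) -> B z.
Proof.
move=> d0 Bz ray; apply: contrapT => nBz; apply: (region_escape d0) Bz => t.
rewrite le_eqVlt => /orP[/eqP <-|/ray nB]; first by rewrite scale0r addr0.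
by move=> Bt; apply: nB; left.
Qed.

(** * Bolts that enclose a rectangle *)

(** Two forbidden values cannot exhaust [a], [b] and the midpoint. *)
Lemma exists_avoiding (R : realType) (a b v v' : R) :
  a < b -> exists y, [/\ a <= y <= b, y <> v & y <> v'].
Proof.
move=> ab; pose m := (a + b) / 2.
have [am mb] : a < m /\ m < b by rewrite /m; split; lra.
have good y : a <= y <= b -> y != v -> y != v' ->
    exists y, [/\ a <= y <= b, y <> v & y <> v'].
  by move=> ? /eqP ? /eqP ?; exists y.
have [Ea|Na] := eqVneq a v; have [Ea'|Na'] := eqVneq a v';
  have [Eb|Nb] := eqVneq b v; have [Eb'|Nb'] := eqVneq b v';
  try (by apply: (good a) => //; lra); try (by apply: (good b) => //; lra);
  by apply: (good m); lra.
Qed.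

Lemma pair_neq0 (R : realType) (a b : R) : (a != 0) || (b != 0) -> (a, b) != 0.
Proof. by move=> h; apply/eqP => -[a0 b0]; rewrite a0 b0 eqxx in h. Qed.

(** The curve lies on two vertical and two horizontal lines, and by [region_edge] it contains all
    four sides of the rectangle. This forces the lines to be those of the sides; the remaining
    freedom affects only the sign. *)
Lemma rectangle_bolt_functional (R : realType) (r : 'I_(2 * 2) -> R * R)
    (x1 x2 y1 y2 : R) (f : R * R -> R) :
  x1 < x2 -> y1 < y2 -> closed_bolt r ->
  enclosed_region r = `[x1, x2] `*` `[y1, y2] ->
  `|bolt_functional f r| = `|increment f x1 x2 y1 y2| / 4.
Proof.
move=> x12 y12 /closed_bolt_unroll -/(_ isT) [s [sS sP surj par sumE]] reg.
have cyc : s 4 = s 0 by apply/eqP; rewrite sP.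
rewrite /bolt_functional normrM (sumE (f \o r)) !big_ord_recl big_ord0 /bump /=.
have := par 0; have := par 1; have := par 2; have := par 3.
rewrite /= cyc.
case E0 : (r (s 0)) => [u v]; case E1 : (r (s 1)) => [u' w].
case E2 : (r (s 2)) => [w1 v']; case E3 : (r (s 3)) => [w2 w3] /=.
move=> ? ? ? ?; subst w w1 w2 w3.
have bdP z : boundary r z -> (z.1 = u \/ z.1 = u') \/ (z.2 = v \/ z.2 = v').
  move=> [i _]; have [k k4 <-] := surj i; rewrite /side sS.
  case: k k4 => [|[|[|[|//]]]] _; rewrite ?cyc ?E0 ?E1 ?E2 ?E3.
  - by move=> /segment_horizontal[]; auto.
  - by move=> /segment_vertical[]; auto.
  - by move=> /segment_horizontal[]; auto.
  - by move=> /segment_vertical[]; auto.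
have edge z d : d != 0 -> (`[x1, x2] `*` `[y1, y2]) z ->
    (forall t, 0 < t -> ~ (`[x1, x2] `*` `[y1, y2]) (z + t *: d)) -> boundary r z.
  by rewrite -reg; exact: region_edge.
(* At a height off both horizontal lines, a point of the curve must lie on one of the vertical
   lines; [x] plays the transposed role. *)
have [y [/andP[ly yh] yv yv']] := exists_avoiding v v' y12.
have [x [/andP[lx xh] xu xu']] := exists_avoiding u u' x12.
have Ex1 : x1 = u \/ x1 = u'.
  have /bdP[//|[]//] : boundary r (x1, y).
  apply: (edge _ (-1, 0)); first by rewrite pair_neq0 // oppr_eq0 oner_eq0.
    by split; rewrite /= in_itv /= ?ly ?yh ?lexx ?ltW.
  by move=> t t0 [/=]; rewrite !in_itv /= /GRing.scale /= => /andP[? ?] _; lra.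
have Ex2 : x2 = u \/ x2 = u'.
  have /bdP[//|[]//] : boundary r (x2, y).
  apply: (edge _ (1, 0)); first by rewrite pair_neq0 // oner_eq0.
    by split; rewrite /= in_itv /= ?ly ?yh ?lexx ?ltW.
  by move=> t t0 [/=]; rewrite !in_itv /= /GRing.scale /= => /andP[? ?] _; lra.
have Ey1 : y1 = v \/ y1 = v'.
  have /bdP[[]|]// : boundary r (x, y1).
  apply: (edge _ (0, -1)); first by rewrite pair_neq0 // oppr_eq0 oner_eq0 orbT.
    by split; rewrite /= in_itv /= ?lx ?xh ?lexx ?ltW.
  by move=> t t0 [_ /=]; rewrite !in_itv /= /GRing.scale /= => /andP[? ?]; lra.
have Ey2 : y2 = v \/ y2 = v'.
  have /bdP[[]|]// : boundary r (x, y2).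
  apply: (edge _ (0, 1)); first by rewrite pair_neq0 // oner_eq0 orbT.
    by split; rewrite /= in_itv /= ?lx ?xh ?lexx ?ltW.
  by move=> t t0 [_ /=]; rewrite !in_itv /= /GRing.scale /= => /andP[? ?]; lra.
rewrite ger0_norm ?invr_ge0 ?ler0n // mulrC; congr (_ * _).
clear - x12 y12 Ex1 Ex2 Ey1 Ey2.
have [[? ?]|[? ?]] : (u = x1 /\ u' = x2) \/ (u = x2 /\ u' = x1).
- by case: Ex1 => ?; case: Ex2 => ?; subst; auto; rewrite ltxx in x12.
- subst u u'; have [[? ?]|[? ?]] : (v = y1 /\ v' = y2) \/ (v = y2 /\ v' = y1).
  + by case: Ey1 => ?; case: Ey2 => ?; subst; auto; rewrite ltxx in y12.
  + by subst v v'; congr (`|_|); rewrite /increment; ring.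
  + by subst v v'; rewrite -normrN; congr (`|_|); rewrite /increment; ring.
- subst u u'; have [[? ?]|[? ?]] : (v = y1 /\ v' = y2) \/ (v = y2 /\ v' = y1).
  + by case: Ey1 => ?; case: Ey2 => ?; subst; auto; rewrite ltxx in y12.
  + by subst v v'; rewrite -normrN; congr (`|_|); rewrite /increment; ring.
  + by subst v v'; congr (`|_|); rewrite /increment; ring.
Qed.

(** * The standard hexagon, its region and its maximal rectangles *)

Lemma in_betweenC (R : realType) (u v w : R) : in_between u v w = in_between v u w.
Proof. by rewrite /in_between orbC. Qed.

Lemma in_between_le (R : realType) (u v w : R) :
  u <= v -> in_between u v w = (u <= w <= v).
Proof.
move=> uv; rewrite /in_between; apply/orP/idP; last by left.
by case=> // /andP[? ?]; apply/andP; split; lra.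
Qed.

(* The vertices are the points [(xi, zj)] with [i != j]: indexing the rows so that
   column [i] omits row [i] makes the curve symmetric in the indices 0, 1, 2. *)
Definition hexagon_curve (R : realType) (x0 x1 x2 z0 z1 z2 : R) : set (R * R) :=
  [set p | [\/ p.1 = x0 /\ in_between z1 z2 p.2,
               p.1 = x1 /\ in_between z0 z2 p.2 |
               p.1 = x2 /\ in_between z0 z1 p.2] \/
           [\/ in_between x1 x2 p.1 /\ p.2 = z0,
               in_between x0 x2 p.1 /\ p.2 = z1 |
               in_between x0 x1 p.1 /\ p.2 = z2]].

(** The alternating sum along the curve, starting at [(x0, z2)]. *)
Definition hexagon_sum (R : realType) (f : R * R -> R) (x0 x1 x2 z0 z1 z2 : R) : R :=
  f (x0, z2) - f (x1, z2) + f (x1, z0) - f (x2, z0) + f (x2, z1) - f (x0, z1).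

Definition L_interior (R : realType) (a1 a2 a3 b1 b2 b3 : R) : set (R * R) :=
  `]a1, a3[ `*` `]b1, b2[ `|` `]a1, a2[ `*` `]b1, b3[.

Lemma L_shapeP (R : realType) (a1 a2 a3 b1 b2 b3 : R) z :
  L_shape a1 a2 a3 b1 b2 b3 z <->
  (a1 <= z.1 <= a3) && (b1 <= z.2 <= b2) \/ (a1 <= z.1 <= a2) && (b1 <= z.2 <= b3).
Proof.
rewrite /L_shape /setU /setX /= !in_itv /=.
by split=> -[] => [[-> ->]|[-> ->]|/andP|/andP]; auto.
Qed.

Lemma L_interiorP (R : realType) (a1 a2 a3 b1 b2 b3 : R) z :
  L_interior a1 a2 a3 b1 b2 b3 z <->
  (a1 < z.1 < a3) && (b1 < z.2 < b2) \/ (a1 < z.1 < a2) && (b1 < z.2 < b3).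
Proof.
rewrite /L_interior /setU /setX /= !in_itv /=.
by split=> -[] => [[-> ->]|[-> ->]|/andP|/andP]; auto.
Qed.

(** The rows are passed as [b2 b1 b3] because the columns [a1], [a2], [a3] omit the rows [b2], [b1],
    [b3] respectively. *)
Lemma hexagon_curveP (R : realType) (a1 a2 a3 b1 b2 b3 : R) z :
  a1 < a2 -> a2 < a3 -> b1 < b2 -> b2 < b3 ->
  hexagon_curve a1 a2 a3 b2 b1 b3 z <->
  [\/ z.1 = a1 /\ b1 <= z.2 <= b3, z.1 = a2 /\ b2 <= z.2 <= b3 |
      z.1 = a3 /\ b1 <= z.2 <= b2] \/
  [\/ a2 <= z.1 <= a3 /\ z.2 = b2, a1 <= z.1 <= a3 /\ z.2 = b1 |
      a1 <= z.1 <= a2 /\ z.2 = b3].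
Proof.
move=> /ltW a12 /ltW a23 /ltW b12 /ltW b23.
have [a13 b13] := (le_trans a12 a23, le_trans b12 b23).
by rewrite /hexagon_curve /= (in_betweenC b2 b1) !in_between_le.
Qed.

Lemma L_shape_split (R : realType) (a1 a2 a3 b1 b2 b3 : R) :
  a1 < a2 -> a2 < a3 -> b1 < b2 -> b2 < b3 ->
  L_shape a1 a2 a3 b1 b2 b3 =
  L_interior a1 a2 a3 b1 b2 b3 `|` hexagon_curve a1 a2 a3 b2 b1 b3.
Proof.
move=> a12 a23 b12 b23.
have LP := @L_shapeP _ a1 a2 a3 b1 b2 b3; have IP := @L_interiorP _ a1 a2 a3 b1 b2 b3.
have BP z := hexagon_curveP z a12 a23 b12 b23.
apply/seteqP; split=> -[x y]; last first.
  by case=> [/IP /= [] h|/BP /= [[]|[]] [h1 h2]]; apply/LP => /=;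
    [left|right|right|right|left|left|left|right]; try subst x; try subst y; lra.
move=> /LP /= h.
have {h}[ax xa bly yb xy] : [/\ a1 <= x, x <= a3, b1 <= y, y <= b3 & x <= a2 \/ y <= b2].
  by case: h => h; split; lra.
have [->|Na1] := eqVneq x a1.
  by right; apply/BP; left; constructor 1 => /=; split=> //; lra.
have [->|Nb1] := eqVneq y b1.
  by right; apply/BP; right; constructor 2 => /=; split=> //; lra.
have [xa2|a2x|xa2] := ltrgtP x a2; have [yb2|b2y|yb2] := ltrgtP y b2.
- by left; apply/IP; left => /=; lra.
- have [yb3|yb3] := eqVneq y b3.
    by right; apply/BP; right; constructor 3 => /=; split=> //; lra.
  by left; apply/IP; right => /=; lra.
- by left; apply/IP; right => /=; lra.
- have [xa3|xa3] := eqVneq x a3.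
    by right; apply/BP; left; constructor 3 => /=; split=> //; lra.
  by left; apply/IP; left => /=; lra.
- by case: xy => ?; lra.
- by right; apply/BP; right; constructor 1 => /=; split=> //; lra.
- by left; apply/IP; left => /=; lra.
- by right; apply/BP; left; constructor 2 => /=; split=> //; lra.
- by right; apply/BP; left; constructor 2 => /=; split=> //; lra.
Qed.

Lemma L_interior_not_curve (R : realType) (a1 a2 a3 b1 b2 b3 : R) z :
  a1 < a2 -> a2 < a3 -> b1 < b2 -> b2 < b3 ->
  L_interior a1 a2 a3 b1 b2 b3 z -> ~ hexagon_curve a1 a2 a3 b2 b1 b3 z.
Proof.
move=> a12 a23 b12 b23.
by case: z => x y /L_interiorP /= [] h /hexagon_curveP -/(_ a12 a23 b12 b23) /=
  [[]|[]] [h1 h2]; try subst x; try subst y; lra.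
Qed.

Lemma open_L_interior (R : realType) (a1 a2 a3 b1 b2 b3 : R) : open (L_interior a1 a2 a3 b1 b2 b3).
Proof.
have fstc : continuous (fst : R * R -> R) by move=> z; exact: cvg_fst.
have sndc : continuous (snd : R * R -> R) by move=> z; exact: cvg_snd.
have openX (a b c d : R) : open (`]a, b[ `*` `]c, d[ : set (R * R)).
  apply: (@openI _ (fst @^-1` `]a, b[) (snd @^-1` `]c, d[));
    by apply: open_comp; [move=> z _; auto|exact: interval_open].
by apply: openU; exact: openX.
Qed.

Lemma closed_L_shape (R : realType) (a1 a2 a3 b1 b2 b3 : R) : closed (L_shape a1 a2 a3 b1 b2 b3).
Proof.
have fstc : continuous (fst : R * R -> R) by move=> z; exact: cvg_fst.
have sndc : continuous (snd : R * R -> R) by move=> z; exact: cvg_snd.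
have closedX (a b c d : R) : closed (`[a, b] `*` `[c, d] : set (R * R)).
  apply: (@closedI _ (fst @^-1` `[a, b]) (snd @^-1` `[c, d]));
    by apply: closed_comp; [move=> z _; auto|exact: interval_closed].
by apply: closedU; exact: closedX.
Qed.

(** A component that meets the open L stays in it and is bounded; from a point outside the closed L,
    a ray in one of five directions avoids the curve. *)
Lemma region_standard_hexagon (R : realType) (a1 a2 a3 b1 b2 b3 : R) :
  a1 < a2 -> a2 < a3 -> b1 < b2 -> b2 < b3 ->
  region (hexagon_curve a1 a2 a3 b2 b1 b3) = L_shape a1 a2 a3 b1 b2 b3.
Proof.
move=> a12 a23 b12 b23.
have LP := @L_shapeP _ a1 a2 a3 b1 b2 b3; have IP := @L_interiorP _ a1 a2 a3 b1 b2 b3.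
have IB z := @L_interior_not_curve _ _ _ _ _ _ _ z a12 a23 b12 b23.
have LIB := L_shape_split a12 a23 b12 b23.
set L := L_shape _ _ _ _ _ _ in LP LIB *; set B := hexagon_curve _ _ _ _ _ _ in IB LIB *.
set I := L_interior _ _ _ _ _ _ in IP IB LIB.
rewrite LIB; apply/seteqP; split=> z; last first.
  case=> Iz; last by left.
  right; split; first exact: IB.
  set C := connected_component (~` B) z.
  (* Off the curve the open and the closed L coincide, so their trace on [C] is both open and closed
     in [C]. *)
  have CI : C `&` I = C.
    apply: (@component_connected _ (~` B) z).
    - by exists z; split=> //; apply: connected_component_refl; exact: IB.
    - by exists I => //; exact: open_L_interior.
    - exists L; first exact: closed_L_shape.
       rewrite LIB; apply/seteqP; split=> w [Cw].
        by move=> Iw; split=> //; left.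
      by case=> // /(connected_component_sub Cw).
  rewrite -/C -CI; exists (`|a1| + `|a3| + `|b1| + `|b3|); split.
    by rewrite ?num_real.
  move=> M hM w [_ Iw]; have /LP : L w by rewrite LIB; left.
  rewrite /= prod_normE ge_max !ler_norml => h.
  have ? := ler_norm a1; have ? : - a1 <= `|a1| by rewrite -normrN ler_norm.
  have ? := normr_ge0 a1.
  have ? := ler_norm a3; have ? : - a3 <= `|a3| by rewrite -normrN ler_norm.
  have ? := normr_ge0 a3.
  have ? := ler_norm b1; have ? : - b1 <= `|b1| by rewrite -normrN ler_norm.
  have ? := normr_ge0 b1.
  have ? := ler_norm b3; have ? : - b3 <= `|b3| by rewrite -normrN ler_norm.
  have ? := normr_ge0 b3.
  by case: h => h; lra.
rewrite -LIB => Bz; apply: contrapT => nLz; move: Bz.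
have escape d : d != 0 -> (forall t, 0 <= t -> ~ L (z + t *: d)) -> ~ region B z.
  move=> d0 ray; apply: (region_escape d0) => t t0 Bt; apply: (ray t t0).
  by rewrite LIB; right.
case: z nLz escape => x y nLz escape.
have [xa1|ax] := ltrP x a1.
  apply: (escape (-1, 0)); first by rewrite pair_neq0 // oppr_eq0 oner_eq0.
  by move=> t t0 /LP; rewrite /= /GRing.scale /= => -[] h; lra.
have [xa3|xa] := ltrP a3 x.
  apply: (escape (1, 0)); first by rewrite pair_neq0 // oner_eq0.
  by move=> t t0 /LP; rewrite /= /GRing.scale /= => -[] h; lra.
have [yb1|bly] := ltrP y b1.
  apply: (escape (0, -1)); first by rewrite pair_neq0 // oppr_eq0 oner_eq0 orbT.
  by move=> t t0 /LP; rewrite /= /GRing.scale /= => -[] h; lra.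
have [yb3|yb] := ltrP b3 y.
  apply: (escape (0, 1)); first by rewrite pair_neq0 // oner_eq0 orbT.
  by move=> t t0 /LP; rewrite /= /GRing.scale /= => -[] h; lra.
have [xa2|xa2] := lerP x a2.
  by case: nLz; apply/LP; right => /=; lra.
have [yb2|yb2] := lerP y b2.
  by case: nLz; apply/LP; left => /=; lra.
(* What remains is the notch, which the diagonal ray leaves without meeting the L. *)
apply: (escape (1, 1)); first by rewrite pair_neq0 // oner_eq0.
by move=> t t0 /LP; rewrite /= /GRing.scale /= => -[] h; lra.
Qed.

(** The arm that holds the upper right corner of [Q] contains all of [Q], and maximality makes them
    equal. *)
Lemma maximal_rectangle_L_shape (R : realType) (a1 a2 a3 b1 b2 b3 : R) (Q : set (R * R)) :
  a1 < a2 -> a2 < a3 -> b1 < b2 -> b2 < b3 ->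
  maximal_rectangle (L_shape a1 a2 a3 b1 b2 b3) Q ->
  Q = `[a1, a3] `*` `[b1, b2] \/ Q = `[a1, a2] `*` `[b1, b3].
Proof.
move=> a12 a23 b12 b23 [[x1 [x2 [y1 [y2 [x12 y12 EQ]]]]] QL maxQ].
have cornerL x y : x1 <= x <= x2 -> y1 <= y <= y2 -> L_shape a1 a2 a3 b1 b2 b3 (x, y).
  by move=> xI yI; apply: QL; rewrite EQ; split; rewrite /= in_itv.
have /L_shapeP /= h1 : L_shape a1 a2 a3 b1 b2 b3 (x1, y1).
  by apply: cornerL; rewrite lexx ?andbT ?andTb ltW.
have /L_shapeP /= h2 : L_shape a1 a2 a3 b1 b2 b3 (x2, y2).
  by apply: cornerL; rewrite lexx ?andbT ?andTb ltW.
have eqmax Q' : is_rectangle Q' -> Q' `<=` L_shape a1 a2 a3 b1 b2 b3 -> Q `<=` Q' -> Q = Q'.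
  move=> rQ' Q'L QQ'; apply: contrapT => QN; apply: (maxQ Q') => //.
  by split=> // Q'Q; apply: QN; apply/seteqP.
case: h2 => h2; [left|right]; apply: eqmax; rewrite ?EQ.
- by exists a1, a3, b1, b2; split=> //; lra.
- by left.
- by move=> [x y] [] /=; rewrite !in_itv /= => ? ?; split; case: h1 => h1; lra.
- by exists a1, a2, b1, b3; split=> //; lra.
- by right.
- by move=> [x y] [] /=; rewrite !in_itv /= => ? ?; split; case: h1 => h1; lra.
Qed.

(** * Reflections of the axes *)

Definition mirror (R : realType) (s t : bool) (z : R * R) : R * R :=
  ((-1) ^+ s * z.1, (-1) ^+ t * z.2).

Lemma mirrorK (R : realType) (s t : bool) : involutive (@mirror R s t).
Proof. by case=> x y; rewrite /mirror /= !mulrA -!signr_addb !addbb !mul1r. Qed.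

Lemma continuous_mirror (R : realType) (s t : bool) : continuous (@mirror R s t).
Proof.
have scaleM (c : R) : continuous ( *%R c : R -> R) by exact: mulrl_continuous.
have c1 : continuous (fun z : R * R => (-1) ^+ s * z.1).
  by move=> z; apply: cvg_comp; [exact: cvg_fst|exact: scaleM].
have c2 : continuous (fun z : R * R => (-1) ^+ t * z.2).
  by move=> z; apply: cvg_comp; [exact: cvg_snd|exact: scaleM].
by move=> z; exact: cvg_pair (c1 z) (c2 z).
Qed.

Lemma norm_mirror (R : realType) (s t : bool) (z : R * R) : `|mirror s t z| = `|z|.
Proof. by rewrite !prod_normE /= !normrM !normr_sign !mul1r. Qed.

Lemma preimage_mirrorK (R : realType) (s t : bool) (A : set (R * R)) :
  mirror s t @^-1` (mirror s t @^-1` A) = A.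
Proof. by apply/seteqP; split=> z; rewrite /= mirrorK. Qed.

(** A reflection is continuous and preserves norms, so it carries bounded components to bounded
    components; as it is an involution, one inclusion suffices. *)
Lemma region_mirror (R : realType) (s t : bool) (B : set (R * R)) :
  region (mirror s t @^-1` B) = mirror s t @^-1` region B.
Proof.
have sub (B' : set (R * R)) : mirror s t @^-1` region B' `<=` region (mirror s t @^-1` B').
  move=> z [Bz|[nBz [M [Mr bnd]]]]; [by left|right; split=> //].
  exists M; split=> // N MN w Cw /=; rewrite -(norm_mirror s t).
  apply: (bnd N MN).
  set C := connected_component (~` (mirror s t @^-1` B')) z in Cw.
  have /(_ (mirror s t w)) : mirror s t @` C `<=` connected_component (~` B') (mirror s t z).
    apply: connected_component_max.
    - by exists z => //; exact: connected_component_refl.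
    - by move=> v [u /connected_component_sub nBu <-].
    - apply: connected_continuous_connected; first exact: component_connected.
      by apply: continuous_subspaceT; exact: continuous_mirror.
  by apply; exists w.
apply/seteqP; split=> // z Bz.
by have := sub (mirror s t @^-1` B) (mirror s t z); rewrite preimage_mirrorK /= mirrorK; apply.
Qed.

Lemma segment_mirror (R : realType) (s t : bool) (u v : R * R) :
  segment (mirror s t u) (mirror s t v) = mirror s t @^-1` segment u v.
Proof.
have lin c (u' v' : R * R) : mirror s t ((1 - c) *: u' + c *: v') =
    (1 - c) *: mirror s t u' + c *: mirror s t v'.
  by case: u' v' => [? ?] [? ?]; rewrite /mirror !segment_pairE /=;
    move: ((-1) ^+ s) ((-1) ^+ t) => a b; congr (_, _); ring.
apply/seteqP; split=> z [c cI Ez]; exists c => //.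
  by rewrite -Ez lin !mirrorK.
by rewrite -lin Ez mirrorK.
Qed.

Lemma boundary_mirror (R : realType) (s t : bool) (m : nat) (p : 'I_m -> R * R) :
  boundary (mirror s t \o p) = mirror s t @^-1` boundary p.
Proof.
by apply/seteqP; split=> z [i _]; rewrite /side /= ?segment_mirror => pz;
  exists i => //; rewrite /side /= ?segment_mirror.
Qed.

Lemma enclosed_region_mirror (R : realType) (s t : bool) (m : nat) (p : 'I_m -> R * R) :
  enclosed_region (mirror s t \o p) = mirror s t @^-1` enclosed_region p.
Proof. by rewrite -region_mirror -boundary_mirror. Qed.

Lemma closed_bolt_mirror (R : realType) (s t : bool) (n : nat) (p : 'I_(2 * n) -> R * R) :
  closed_bolt p -> closed_bolt (mirror s t \o p).
Proof.
move=> [neq [b pb]]; split; first by move=> i /(can_inj (@mirrorK _ s t)); exact: neq.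
by exists b => i; have := pb i; case: ifP => _ /= ->.
Qed.

Lemma is_rectangle_mirror (R : realType) (s t : bool) (Q : set (R * R)) :
  is_rectangle Q -> is_rectangle (mirror s t @^-1` Q).
Proof.
have itv (c : bool) (a b : R) : a < b ->
    exists a' b', a' < b' /\ forall x, (a <= (-1) ^+ c * x <= b) = (a' <= x <= b').
  move=> ab; case: c; last by exists a, b; split=> // x; rewrite expr0 mul1r.
  exists (- b), (- a); split=> [|x]; first by rewrite ltrN2.
  by rewrite expr1 mulN1r lerNr lerNl andbC.
move=> [x1 [x2 [y1 [y2 [x12 y12 ->]]]]].
have [a1 [a2 [a12 aE]]] := itv s _ _ x12; have [b1 [b2 [b12 bE]]] := itv t _ _ y12.
exists a1, a2, b1, b2; split=> //.
by apply/seteqP; split=> z; rewrite /setX /= !in_itv /= aE bE.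
Qed.

Lemma maximal_rectangle_mirror (R : realType) (s t : bool) (H Q : set (R * R)) :
  maximal_rectangle H Q ->
  maximal_rectangle (mirror s t @^-1` H) (mirror s t @^-1` Q).
Proof.
move=> [rQ QH maxQ]; split; first exact: is_rectangle_mirror.
  by move=> z; exact: QH.
move=> Q' rQ' Q'H [QQ' Q'Q].
apply: (maxQ (mirror s t @^-1` Q')); first exact: is_rectangle_mirror.
  by move=> z /Q'H; rewrite /= mirrorK.
split=> [z Qz|Q'Q2]; first by apply: QQ'; rewrite /= mirrorK.
by apply: Q'Q => z Qz; apply: Q'Q2; rewrite /= mirrorK.
Qed.

(** Each reversed axis changes the sign of the mixed difference, which the factor compensates. *)
Lemma class_M_mirror (R : realType) (s t : bool) (H : set (R * R)) (f : R * R -> R) :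
  class_M H f ->
  class_M (mirror s t @^-1` H) (fun z => (-1) ^+ (s (+) t) * f (mirror s t z)).
Proof.
move=> [fc fM]; split.
  have fTc : {within mirror s t @^-1` H, continuous (f \o mirror s t)}.
    apply/subspace_continuousP => z Hz.
    have /subspace_continuousP/(_ _ Hz) fz := fc.
    apply: cvg_comp fz => A; rewrite /= /nbhs /= => /continuous_mirror nA.
    exact: nA.
  move=> z; exact: continuousM (cvg_cst _) (fTc z).
move=> x1 x2 y1 y2 x12 y12 sub.
have subH (u1 u2 v1 v2 : R) :
    `[u1, u2] `*` `[v1, v2] `<=` mirror s t @^-1` (`[x1, x2] `*` `[y1, y2]) ->
    `[u1, u2] `*` `[v1, v2] `<=` H.
  by move=> uv z /uv /sub; rewrite /= mirrorK.
case: s t subH {sub} => -[] subH; rewrite /mirror /= ?expr0 ?expr1 ?mul1r ?mulN1r.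
- have := fM (- x2) (- x1) (- y2) (- y1); rewrite !ltrN2 => /(_ x12 y12) h.
  suff : `[- x2, - x1] `*` `[- y2, - y1] `<=` H by move=> /h; lra.
  by apply: subH => z [] /=; rewrite !in_itv /= => zx zy; split;
    rewrite ?expr1 ?mulN1r lerNr lerNl andbC.
- have := fM (- x2) (- x1) y1 y2; rewrite ltrN2 => /(_ x12 y12) h.
  suff : `[- x2, - x1] `*` `[y1, y2] `<=` H by move=> /h; lra.
  by apply: subH => z [] /=; rewrite !in_itv /= => zx zy; split;
    rewrite ?expr0 ?expr1 ?mul1r ?mulN1r // lerNr lerNl andbC.
- have := fM x1 x2 (- y2) (- y1); rewrite ltrN2 => /(_ x12 y12) h.
  suff : `[x1, x2] `*` `[- y2, - y1] `<=` H by move=> /h; lra.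
  by apply: subH => z [] /=; rewrite !in_itv /= => zx zy; split;
    rewrite ?expr0 ?expr1 ?mul1r ?mulN1r // lerNr lerNl andbC.
- have := fM x1 x2 y1 y2; move=> /(_ x12 y12) h.
  suff : `[x1, x2] `*` `[y1, y2] `<=` H by move=> /h; lra.
  by apply: subH => z [] /=; rewrite !in_itv /= => zx zy; split;
    rewrite ?expr0 ?mul1r.
Qed.

(** * Normal form of a simple bolt with six points *)

(** The curve and the functional are parameters so that this record survives index permutations and
    reflections. The last three clauses exclude a crossing at each [(xi, zi)]. *)
Definition hexagon_data (R : realType) (C : set (R * R))
    (l : (R * R -> R) -> R) (x0 x1 x2 z0 z1 z2 : R) :=
  [/\ C = hexagon_curve x0 x1 x2 z0 z1 z2,
      forall f, `|l f| = `|hexagon_sum f x0 x1 x2 z0 z1 z2| / 6,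
      [/\ x0 != x1, x1 != x2 & x0 != x2], [/\ z0 != z1, z1 != z2 & z0 != z2] &
      [/\ ~~ (in_between x1 x2 x0 && in_between z1 z2 z0),
          ~~ (in_between x0 x2 x1 && in_between z0 z2 z1) &
          ~~ (in_between x0 x1 x2 && in_between z0 z1 z2)]].

Lemma hexagon_bolt_data (R : realType) (h : 'I_(2 * 3) -> R * R) :
  closed_bolt h -> simple_bolt h ->
  exists x0 x1 x2 z0 z1 z2,
    hexagon_data (boundary h) (fun f => bolt_functional f h) x0 x1 x2 z0 z1 z2.
Proof.
move=> hb simple; have [neq _] := hb.
have [s [sS sP surj par sumE]] := closed_bolt_unroll (isT : 0 < 3)%N hb.
have cyc : s 6 = s 0 by apply/eqP; rewrite sP.
(* The two sides that could cross at [(xi, zi)] are three steps apart. *)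
have opposite k z : (k < 3)%N -> segment (h (s k)) (h (s k.+1)) z ->
    segment (h (s k.+3)) (h (s k.+4)) z -> False.
  move=> k3 kz k3z; suff : (side h (s k) `&` side h (s k.+3)) z.
    rewrite simple //; apply/eqP; rewrite ?sS sP;
      by case: k k3 {kz k3z} => [|[|[|//]]].
  by split; rewrite /side sS.
have nq k : h (s k) <> h (s k.+1) by rewrite -sS; exact: neq.
have := par 0; have := par 1; have := par 2; have := par 3; have := par 4; have := par 5.
have := opposite 0 ^~ isT; have := opposite 1 ^~ isT; have := opposite 2 ^~ isT.
have := nq 0; have := nq 1; have := nq 2; have := nq 3; have := nq 4; have := nq 5.
rewrite /= cyc.
(* The names are chosen so that column [xi] has no vertex in row [zi]. *)
case E0 : (h (s 0)) => [x0 z2]; case E1 : (h (s 1)) => [x1 w].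
case E2 : (h (s 2)) => [w1 z0]; case E3 : (h (s 3)) => [x2 w2].
case E4 : (h (s 4)) => [w3 z1]; case E5 : (h (s 5)) => [w4 w5] /=.
move=> n5 n4 n3 n2 n1 n0 o2 o1 o0 ? ? ? ? ? ?; subst w w1 w2 w3 w4 w5.
exists x0, x1, x2, z0, z1, z2; split.
- apply/seteqP; split=> z.
    move=> [i _]; have [k k6 <-] := surj i; rewrite /side sS.
    case: k k6 => [|[|[|[|[|[|//]]]]]] _; rewrite ?cyc ?E0 ?E1 ?E2 ?E3 ?E4 ?E5.
    + by move=> /segment_horizontal; right; constructor 3.
    + by move=> /segment_vertical; rewrite in_betweenC; left; constructor 2.
    + by move=> /segment_horizontal; right; constructor 1.
    + by move=> /segment_vertical; left; constructor 3.
    + by move=> /segment_horizontal; rewrite in_betweenC; right; constructor 2.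
    + by move=> /segment_vertical; left; constructor 1.
  have bd k : segment (h (s k)) (h (s k.+1)) z -> boundary h z.
    by exists (s k) => //; rewrite /side sS.
  case=> [[]|[]] zs.
  + by apply: (bd 5); rewrite cyc E5 E0; apply/segment_vertical.
  + by apply: (bd 1); rewrite E1 E2; apply/segment_vertical; rewrite in_betweenC.
  + by apply: (bd 3); rewrite E3 E4; apply/segment_vertical.
  + by apply: (bd 2); rewrite E2 E3; apply/segment_horizontal.
  + by apply: (bd 4); rewrite E4 E5; apply/segment_horizontal; rewrite in_betweenC.
  + by apply: (bd 0); rewrite E0 E1; apply/segment_horizontal.
- move=> f; rewrite /bolt_functional normrM (sumE (f \o h)) !big_ord_recl big_ord0 /bump /=.
  rewrite E0 E1 E2 E3 E4 E5 ger0_norm ?invr_ge0 ?ler0n // mulrC; congr (`|_| * _).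
  by rewrite /hexagon_sum; ring.
- by split; apply/eqP => E; subst.
- by split; apply/eqP => E; subst.
split; apply/negP => /andP[bx bz].
- by apply: (o2 (x0, z0)); [apply/segment_horizontal|apply/segment_vertical].
- apply: (o1 (x1, z1)); [apply/segment_vertical|apply/segment_horizontal].
    by rewrite in_betweenC.
  by rewrite in_betweenC.
- by apply: (o0 (x2, z2)); [apply/segment_horizontal|apply/segment_vertical].
Qed.

Lemma hexagon_curve_swap01 (R : realType) (x0 x1 x2 z0 z1 z2 : R) :
  hexagon_curve x0 x1 x2 z0 z1 z2 = hexagon_curve x1 x0 x2 z1 z0 z2.
Proof.
have sub y0 y1 y2 w0 w1 w2 :
    @hexagon_curve R y0 y1 y2 w0 w1 w2 `<=` hexagon_curve y1 y0 y2 w1 w0 w2.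
  move=> z [[]|[]] /=; rewrite /hexagon_curve /= => zs;
    rewrite ?(in_betweenC y1 y0) ?(in_betweenC w1 w0);
    by [left; constructor 1|left; constructor 2|left; constructor 3|
        right; constructor 1|right; constructor 2|right; constructor 3].
by apply/seteqP; split; exact: sub.
Qed.

Lemma hexagon_curve_swap12 (R : realType) (x0 x1 x2 z0 z1 z2 : R) :
  hexagon_curve x0 x1 x2 z0 z1 z2 = hexagon_curve x0 x2 x1 z0 z2 z1.
Proof.
have sub y0 y1 y2 w0 w1 w2 :
    @hexagon_curve R y0 y1 y2 w0 w1 w2 `<=` hexagon_curve y0 y2 y1 w0 w2 w1.
  move=> z [[]|[]] /=; rewrite /hexagon_curve /= => zs;
    rewrite ?(in_betweenC y2 y1) ?(in_betweenC w2 w1);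
    by [left; constructor 1|left; constructor 2|left; constructor 3|
        right; constructor 1|right; constructor 2|right; constructor 3].
by apply/seteqP; split; exact: sub.
Qed.

(** A transposition of the indices reverses the orientation of the curve, so [hexagon_sum] only
    changes sign. *)
Lemma hexagon_data_swap01 (R : realType) (C : set (R * R)) l (x0 x1 x2 z0 z1 z2 : R) :
  hexagon_data C l x0 x1 x2 z0 z1 z2 -> hexagon_data C l x1 x0 x2 z1 z0 z2.
Proof.
move=> [-> lE [x01 x12 x02] [z01 z12 z02] [n0 n1 n2]]; split.
- exact: hexagon_curve_swap01.
- by move=> f; rewrite lE -normrN; congr (`|_| / _); rewrite /hexagon_sum; ring.
- by split=> //; rewrite eq_sym.
- by split=> //; rewrite eq_sym.
- by split=> //; rewrite (in_betweenC x1 x0) (in_betweenC z1 z0).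
Qed.

Lemma hexagon_data_swap12 (R : realType) (C : set (R * R)) l (x0 x1 x2 z0 z1 z2 : R) :
  hexagon_data C l x0 x1 x2 z0 z1 z2 -> hexagon_data C l x0 x2 x1 z0 z2 z1.
Proof.
move=> [-> lE [x01 x12 x02] [z01 z12 z02] [n0 n1 n2]]; split.
- exact: hexagon_curve_swap12.
- by move=> f; rewrite lE -normrN; congr (`|_| / _); rewrite /hexagon_sum; ring.
- by split=> //; rewrite eq_sym.
- by split=> //; rewrite eq_sym.
- by split=> //; rewrite (in_betweenC x2 x1) (in_betweenC z2 z1).
Qed.

Lemma in_between_sign (R : realType) (s : bool) (u v w : R) :
  in_between ((-1) ^+ s * u) ((-1) ^+ s * v) ((-1) ^+ s * w) = in_between u v w.
Proof.
case: s; rewrite ?expr0 ?expr1 ?mul1r // !mulN1r /in_between !lerN2.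
by rewrite orbC; congr (_ || _); rewrite andbC.
Qed.

Lemma in_between_signr (R : realType) (s : bool) (u v w : R) :
  in_between ((-1) ^+ s * u) ((-1) ^+ s * v) w = in_between u v ((-1) ^+ s * w).
Proof. by rewrite -[RHS](in_between_sign s) [_ * (_ * w)]mulrA -signr_addb addbb mul1r. Qed.

Lemma hexagon_data_mirror (R : realType) (s t : bool) (C : set (R * R)) l
    (x0 x1 x2 z0 z1 z2 : R) :
  hexagon_data C l x0 x1 x2 z0 z1 z2 ->
  hexagon_data (mirror s t @^-1` C) (fun f => l (f \o mirror s t))
    ((-1) ^+ s * x0) ((-1) ^+ s * x1) ((-1) ^+ s * x2)
    ((-1) ^+ t * z0) ((-1) ^+ t * z1) ((-1) ^+ t * z2).
Proof.
have signK (c : bool) (x y : R) : (x = (-1) ^+ c * y) = ((-1) ^+ c * x = y).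
  by apply/propext; split=> [->|<-]; rewrite mulrA -signr_addb addbb mul1r.
have inj (c : bool) (x y : R) : ((-1) ^+ c * x != (-1) ^+ c * y) = (x != y).
  by rewrite (inj_eq (mulfI _)) // signr_eq0.
move=> [-> lE [x01 x12 x02] [z01 z12 z02] [n0 n1 n2]]; split.
- by apply/seteqP; split=> z; rewrite /hexagon_curve /= !in_between_signr !signK.
- by move=> f; rewrite lE.
- by rewrite !inj.
- by rewrite !inj.
- by rewrite !in_between_sign.
Qed.

Lemma hexagon_data_sorted (R : realType) (C : set (R * R)) l (x0 x1 x2 z0 z1 z2 : R) :
  hexagon_data C l x0 x1 x2 z0 z1 z2 ->
  exists x0' x1' x2' z0' z1' z2',
    [/\ x0' < x1', x1' < x2' & hexagon_data C l x0' x1' x2' z0' z1' z2'].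
Proof.
wlog x01 : x0 x1 z0 z1 / x0 < x1 => [sym D|].
  have [_ _ [x01 _ _] _ _] := D; have [lt01|lt10|E] := ltrgtP x0 x1.
  - exact: sym D.
  - exact: sym (hexagon_data_swap01 D).
  - by rewrite E eqxx in x01.
move=> D; have [_ _ [_ x12 x02] _ _] := D.
have [lt12|lt21|E] := ltrgtP x1 x2; last by rewrite E eqxx in x12.
  by exists x0, x1, x2, z0, z1, z2.
have D' := hexagon_data_swap12 D.
have [lt02|lt20|E] := ltrgtP x0 x2; last by rewrite E eqxx in x02.
  by exists x0, x2, x1, z0, z2, z1.
by exists x2, x0, x1, z2, z0, z1; split=> //; exact: hexagon_data_swap01.
Qed.

(** With increasing abscissas, the absence of a crossing at [(x1, z1)] makes [z1] the least or the
    greatest ordinate. Reversing the second axis makes it the least; reversing the first arranges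
    the order of the other two. *)
Lemma hexagon_data_standard (R : realType) (C : set (R * R)) l (x0 x1 x2 z0 z1 z2 : R) :
  hexagon_data C l x0 x1 x2 z0 z1 z2 ->
  exists s t a1 a2 a3 b1 b2 b3,
    [/\ a1 < a2 /\ a2 < a3, b1 < b2 /\ b2 < b3 &
      hexagon_data (mirror s t @^-1` C) (fun f => l (f \o mirror s t))
        a1 a2 a3 b2 b1 b3].
Proof.
case/hexagon_data_sorted => {}x0 [{}x1 [{}x2 [{}z0 [{}z1 [{}z2 [x01 x12 D]]]]]].
have [_ _ _ [z01 z12 z02] [_ n1 _]] := D.
have x1m : in_between x0 x2 x1 by apply/orP; left; rewrite !ltW.
(* Three adjacent transpositions exchange the indices 0 and 2, restoring increasing abscissas after
   the first axis is reversed. *)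
have rot s t := hexagon_data_swap01 (hexagon_data_swap12 (hexagon_data_swap01
  (hexagon_data_mirror s t D))).
rewrite x1m /in_between negb_or !negb_and -!ltNge /= in n1.
have [lt01|lt10|E] := ltrgtP z0 z1; last by rewrite E eqxx in z01.
  have lt21 : z2 < z1.
    by rewrite ltNge; apply/negP => z1z2; move: n1; rewrite !ltNge z1z2 ltW.
  have [lt02|lt20|E] := ltrgtP z0 z2; last by rewrite E eqxx in z02.
    exists true, true; do 6!eexists; split; last exact: (rot true true).
      by rewrite !expr1 !mulN1r !ltrN2.
    by rewrite !expr1 !mulN1r !ltrN2.
  exists false, true; do 6!eexists; split; last exact: hexagon_data_mirror D.
    by rewrite !expr0 !mul1r.
  by rewrite !expr1 !mulN1r !ltrN2.
have lt12 : z1 < z2.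
  by rewrite ltNge; apply/negP => z2z1; move: n1; rewrite !ltNge z2z1 (ltW lt10) andbF.
have [lt02|lt20|E] := ltrgtP z0 z2; last by rewrite E eqxx in z02.
  exists false, false; do 6!eexists; split; last exact: hexagon_data_mirror D.
    by rewrite !expr0 !mul1r.
  by rewrite !expr0 !mul1r.
exists true, false; do 6!eexists; split; last exact: (rot true false).
  by rewrite !expr1 !mulN1r !ltrN2.
by rewrite !expr0 !mul1r.
Qed.

(** * Transport to the standard L and conclusion *)

Lemma vertex_boundary (R : realType) (m : nat) (p : 'I_m -> R * R) i : boundary p (p i).
Proof.
exists i => //; exists 0; first by rewrite /= in_itv /= lexx ler01.
by rewrite subr0 scale1r scale0r addr0.
Qed.

Lemma bolt_functional_mirror (R : realType) (s t : bool) (n : nat) (f : R * R -> R)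
    (p : 'I_(2 * n) -> R * R) :
  `|bolt_functional (fun z => (-1) ^+ (s (+) t) * f (mirror s t z)) (mirror s t \o p)| =
  `|bolt_functional f p|.
Proof.
rewrite /bolt_functional -[RHS]mul1r -[X in _ = X * _](normr_sign R (s (+) t)) -[RHS]normrM.
congr (`|_|); rewrite [RHS]mulrCA [X in _ = _ * X]mulr_sumr; congr (_ * _); apply: eq_bigr => i _.
by rewrite /= mirrorK mulrCA.
Qed.

(** The approximation is built for the reflected function [g] and carried back to [f]; whichever
    polygon attains the maximum supplies the bolt for [approx_error_eq]. *)
Lemma hexagon_approx_error (R : realType) (s t : bool) (a1 a2 a3 b1 b2 b3 : R)
    (H : set (R * R)) (h : 'I_(2 * 3) -> R * R) (r1 r2 : 'I_(2 * 2) -> R * R)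
    (f : R * R -> R) :
  a1 < a2 -> a2 < a3 -> b1 < b2 -> b2 < b3 ->
  closed_bolt h -> closed_bolt r1 -> closed_bolt r2 ->
  (forall i, H (h i)) -> (forall i, H (r1 i)) -> (forall i, H (r2 i)) ->
  (forall g, `|bolt_functional (g \o mirror s t) h| =
    `|hexagon_sum g a1 a2 a3 b2 b1 b3| / 6) ->
  mirror s t @^-1` H = L_shape a1 a2 a3 b1 b2 b3 ->
  mirror s t @^-1` enclosed_region r1 = `[a1, a3] `*` `[b1, b2] ->
  mirror s t @^-1` enclosed_region r2 = `[a1, a2] `*` `[b1, b3] ->
  class_M H f ->
  approx_error f H =
  Num.max `|bolt_functional f h|
    (Num.max `|bolt_functional f r1| `|bolt_functional f r2|).
Proof.
move=> a12 a23 b12 b23 hb rb1 rb2 Hh Hr1 Hr2 lh HL HW HT fM.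
have a13 := lt_trans a12 a23; have b13 := lt_trans b12 b23.
pose g z := (-1) ^+ (s (+) t) * f (mirror s t z).
have fE z : f z = (-1) ^+ (s (+) t) * g (mirror s t z).
  by rewrite /g mirrorK mulrA -signr_addb addbb mul1r.
have gM : class_M (L_shape a1 a2 a3 b1 b2 b3) g.
  by rewrite -HL; exact: class_M_mirror.
set lh' := `|bolt_functional f h|; set l1 := `|bolt_functional f r1|.
set l2 := `|bolt_functional f r2|; set M := Num.max lh' (Num.max l1 l2).
have E1 : l1 = `|increment g a1 a3 b1 b2| / 4.
  rewrite /l1 -(bolt_functional_mirror s t).
  apply: rectangle_bolt_functional => //; first exact: closed_bolt_mirror.
  by rewrite enclosed_region_mirror.
have E2 : l2 = `|increment g a1 a2 b1 b3| / 4.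
  rewrite /l2 -(bolt_functional_mirror s t).
  apply: rectangle_bolt_functional => //; first exact: closed_bolt_mirror.
  by rewrite enclosed_region_mirror.
(* Up to sign, the alternating sum over the hexagon is the mass of the whole L. *)
have Eh : lh' = `|increment g a1 a3 b1 b2 + increment g a1 a2 b2 b3| / 6.
  rewrite /lh' -(bolt_functional_mirror s t).
  have -> : bolt_functional (fun z => (-1) ^+ (s (+) t) * f (mirror s t z)) (mirror s t \o h)
      = bolt_functional (g \o mirror s t) h.
    by [].
  by rewrite lh -normrN; congr (`|_| / _); rewrite /hexagon_sum /increment; ring.
have [Ml1 Ml2 Mlh] : [/\ l1 <= M, l2 <= M & lh' <= M].
  by rewrite /M !le_max !lexx !orbT.
have [|||||phi [psi [phic psic gP]]] :=
  @L_shape_approximation R a1 a2 a3 b1 b2 b3 M g _ _ gM.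
- by rewrite !ltW.
- by rewrite !ltW.
- by have := ler_norm (increment g a1 a3 b1 b2); rewrite E1 in Ml1; lra.
- by have := ler_norm (increment g a1 a2 b1 b3); rewrite E2 in Ml2; lra.
- have := ler_norm (increment g a1 a3 b1 b2 + increment g a1 a2 b2 b3).
  by rewrite Eh in Mlh; lra.
have signc (u : R -> R) (c d : bool) : continuous u ->
    continuous (fun x : R => (-1) ^+ c * u ((-1) ^+ d * x)).
  move=> uc x; have mulc (k : R) : continuous ( *%R k : R -> R) by exact: mulrl_continuous.
  by apply: continuous_comp; [apply: continuous_comp|]; [exact: mulc|exact: uc|exact: mulc].
have fP z : H z -> `|f z - (-1) ^+ (s (+) t) * phi ((-1) ^+ s * z.1) -
    (-1) ^+ (s (+) t) * psi ((-1) ^+ t * z.2)| <= M.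
  move=> Hz; rewrite fE -!mulrBr normrM normr_sign mul1r.
  by apply: (gP (mirror s t z)); rewrite -HL /= mirrorK.
have concl n (p : 'I_(2 * n) -> R * R) : (0 < n)%N -> closed_bolt p ->
    (forall i, H (p i)) -> M = `|bolt_functional f p| -> approx_error f H = M.
  move=> n0 pb Hp ME.
  by apply: approx_error_eq n0 pb Hp ME (signc _ _ _ phic) (signc _ _ _ psic) fP.
have [] : [\/ M = lh', M = l1 | M = l2].
  rewrite /M; have [_|_] := lerP (Num.max l1 l2) lh'; first by constructor 1.
  by have [_|_] := lerP l2 l1; [constructor 2|constructor 3].
- exact: concl hb Hh.
- exact: concl rb1 Hr1.
- exact: concl rb2 Hr2.
Qed.

Theorem theorem3p5 (R : realType) (H R1 R2 : set (R * R))
    (h : 'I_(2 * 3) -> R * R) (r1 r2 : 'I_(2 * 2) -> R * R) (f : R * R -> R)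
    (hexagon_H : polygon_with_vertices H h)
    (max_R1 : maximal_rectangle H R1) (max_R2 : maximal_rectangle H R2)
    (H_eq : H = R1 `|` R2)
    (vertices_R1 : polygon_with_vertices R1 r1)
    (vertices_R2 : polygon_with_vertices R2 r2)
    (f_M : class_M H f) :
  approx_error f H =
  Num.max `|bolt_functional f h|
    (Num.max `|bolt_functional f r1| `|bolt_functional f r2|).
Proof.
have [hb hsimple HE] := hexagon_H.
have [r1b _ R1E] := vertices_R1; have [r2b _ R2E] := vertices_R2.
have [x0 [x1 [x2 [z0 [z1 [z2]]]]]] := hexagon_bolt_data hb hsimple.
case/hexagon_data_standard => s [t [a1 [a2 [a3 [b1 [b2 [b3
  [[a12 a23] [b12 b23] [CE lE _ _ _]]]]]]]]].
have HL : mirror s t @^-1` H = L_shape a1 a2 a3 b1 b2 b3.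
  by rewrite -(region_standard_hexagon a12 a23 b12 b23) -CE region_mirror HE.
have Hh i : H (h i) by rewrite HE; left; exact: vertex_boundary.
have Hr1 i : H (r1 i) by rewrite H_eq R1E; left; left; exact: vertex_boundary.
have Hr2 i : H (r2 i) by rewrite H_eq R2E; right; left; exact: vertex_boundary.
have := maximal_rectangle_mirror s t max_R1.
rewrite HL => /(maximal_rectangle_L_shape a12 a23 b12 b23) Q1.
have := maximal_rectangle_mirror s t max_R2.
rewrite HL => /(maximal_rectangle_L_shape a12 a23 b12 b23) Q2.
have cover z : L_shape a1 a2 a3 b1 b2 b3 z ->
    (mirror s t @^-1` R1) z \/ (mirror s t @^-1` R2) z.
  by rewrite -HL H_eq.
case: Q1 => Q1; case: Q2 => Q2.
(* If both rectangles were the horizontal arm, the top of the vertical arm would be left uncovered;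
   the last case is symmetric. *)
- have /cover : L_shape a1 a2 a3 b1 b2 b3 (a1, b3).
    by apply/L_shapeP; right => /=; lra.
  by rewrite Q1 Q2 => -[] []; rewrite /= !in_itv /=; lra.
- by apply: (hexagon_approx_error a12 a23 b12 b23 hb r1b r2b) lE HL _ _ f_M => //;
    rewrite -?R1E -?R2E.
- rewrite [X in Num.max _ X]maxC.
  by apply: (hexagon_approx_error a12 a23 b12 b23 hb r2b r1b) lE HL _ _ f_M => //;
    rewrite -?R1E -?R2E.
- have /cover : L_shape a1 a2 a3 b1 b2 b3 (a3, b1).
    by apply/L_shapeP; left => /=; lra.
  by rewrite Q1 Q2 => -[] []; rewrite /= !in_itv /=; lra.
Qed.
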